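(* Let $A,B\in\mathcal{S}_n$, $X\in\mathcal{M}_n$ and $r\ge 0$, and let $|||\cdot|||$ be a unitarily invariant norm on $\mathcal{M}_n$. Then for all $s,t\in[0,1]$, \begin{align*} |||\,|A^{1/2}XB^{1/2}|^r\,|||^2 &\le |||\,|A^{t}XB^{1-s}|^r\,|||\;|||\,|A^{1-t}XB^{s}|^r\,|||\\ &\le \max\big\{\,|||\,|AX|^r\,|||\;|||\,|XB|^r\,|||,\; |||\,|AXB|^r\,|||\;|||\,|X|^r\,|||\,\big\}. \end{align*}
   Context: $\mathcal{M}_n$ is the algebra of $n\times n$ complex matrices, and $\mathcal{S}_n\subset\mathcal{M}_n$ is the set of positive semidefinite matrices. For $T\in\mathcal{M}_n$, $|T|=(T^*T)^{1/2}$. Nonnegative real powers of positive semidefinite matrices are taken by functional calculus, with the zeroth power equal to the identity matrix. A norm $|||\cdot|||$ on $\mathcal{M}_n$ is unitarily invariant if $|||UTV|||=|||T|||$ for all $T\in\mathcal{M}_n$ and all unitary $U,V\in\mathcal{M}_n$. *)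

(* Defs.v *)
From mathcomp Require Import all_boot all_order all_algebra.
From mathcomp Require Import complex.
From mathcomp Require Import reals exp.

Set Implicit Arguments.
Unset Strict Implicit.
Unset Printing Implicit Defensive.

Import Order.TTheory GRing.Theory Num.Theory.
Local Open Scope ring_scope.
Local Open Scope complex_scope.
Local Open Scope sesquilinear_scope.

(* In R[i], 0 <= z means that z is a nonnegative real. *)
Definition psdmx (R : realType) (n : nat) (A : 'M[R[i]]_n) : Prop :=
  A \is hermsymmx /\ forall x : 'cV[R[i]]_n, 0 <= (x^t* *m A *m x) 0 0.

(* A = U^* diag(lambda) U with U = spectralmx A unitary, when A is normal.
   For positive semidefinite A the eigenvalues are nonnegative reals, so taking
   their real parts loses nothing; otherwise the value is meaningless.
   As powR 0 0 = 1, the zeroth power is the identity even for singular A. *)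
Definition mxpowR (R : realType) (n : nat) (A : 'M[R[i]]_n) (p : R) :
    'M[R[i]]_n :=
  (spectralmx A)^t* *m
  diag_mx (map_mx (fun z : R[i] => (powR (complex.Re z) p)%:C) (spectral_diag A))
  *m spectralmx A.

Definition mxabs (R : realType) (n : nat) (T : 'M[R[i]]_n) : 'M[R[i]]_n :=
  mxpowR (T^t* *m T) 2^-1.

(* normc a is the modulus of a as an element of R, while `|a| lies in R[i]. *)
Record mxnorm (R : realType) (n : nat) (N : 'M[R[i]]_n -> R) : Prop := MxNorm {
  mxnorm_ge0 : forall T, 0 <= N T;
  mxnorm_eq0 : forall T, N T = 0 -> T = 0;
  mxnormZ : forall (a : R[i]) T, N (a *: T) = ComplexField.Normc.normc a * N T;
  mxnormD : forall S T, N (S + T) <= N S + N T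
}.

Definition unitarily_invariant (R : realType) (n : nat)
    (N : 'M[R[i]]_n -> R) : Prop :=
  forall T U V : 'M[R[i]]_n, U \is unitarymx -> V \is unitarymx ->
    N (U *m T *m V) = N T.

(* Main.v *)
Require Import Defs.
From mathcomp Require Import all_boot all_order all_algebra.
From mathcomp Require Import complex.
From mathcomp Require Import reals exp.
From mathcomp Require Import perm ring lra.

(** Write sigma_1(T) >= sigma_2(T) >= ... for the singular values of T, P_k(T)
    for the product of the k largest, and nu(T) for the norm of |T|^r.  The
    function (p, q) |-> log nu(A^p X B^q) is jointly convex on the unit square.
    Its symmetrization about the centre is smallest at the centre, which is
    the first inequality, and is bounded by its values at the corners, which
    is the second.  Only two instances of the convexity are needed: midpoint
    convexity between (t, 1-s) and (1-t, s), and convexity in one variable at a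
    time between the sides of the square.

    Convexity is first proved for log P_k, for every k.  Classically P_k(T) is
    the operator norm of the k-th exterior power of T; here it is read off
    Gram determinants: det((TW)^* (TW)) <= P_k(T)^2 det(W^* W) for every n x k
    matrix W, with equality on the top right singular vectors (gram_mul_le,
    top_frame).  The Cauchy-Binet formula turns Gram determinants into weighted
    sums over minors.  Hoelder's inequality for these sums gives convexity in
    the exponent of A alone (topprod_mxpowRl); exponents of B follow by taking
    adjoints, which preserve singular values (topprod_adj_le).  The midpoint
    inequality (topprod_similar) is the exterior-power version of the argument
    that |T|^2 is the spectral radius of T^* T, that the spectral radius is
    invariant under cyclic permutation of factors, and that it is dominated by
    the norm.

    To pass from the P_k to an arbitrary norm, N is viewed as a symmetric gauge
    function on nonnegative diagonals.  Domination of all the products of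
    leading entries implies domination of the gauge (log_dominance), and a
    gauge satisfies Hoelder's inequality (gauge_hoelder).  Together they give
    nu(T) <= nu(T1)^t nu(T0)^(1-t) whenever the same inequality holds between
    the P_k (nu_hoelder). *)

Set Implicit Arguments.
Unset Strict Implicit.
Unset Printing Implicit Defensive.

Import Order.TTheory GRing.Theory Num.Theory.
Import ComplexField.Normc.
Local Open Scope ring_scope.
Local Open Scope complex_scope.
Local Open Scope sesquilinear_scope.

(** * Gauge functions: Hoelder's inequality and log-majorization *)

(** The middle field packs homogeneity, subadditivity and monotonicity on
    nonnegative functions into one condition.  Sums over a finite type and
    norms of diagonal matrices are both instances, so that Hoelder's inequality
    is proved once. *)
Record gauge (R : realType) (I : finType) (Phi : (I -> R) -> R) : Prop :=
  Gauge {
  gauge_ge0 : forall x, 0 <= Phi x;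
  gauge_sublinear : forall x y z a b, 0 <= a -> 0 <= b ->
    (forall i, 0 <= x i) -> (forall i, 0 <= y i) ->
    (forall i, 0 <= z i <= a * x i + b * y i) ->
    Phi z <= a * Phi x + b * Phi y;
  gauge_eq0 : forall x, (forall i, 0 <= x i) -> Phi x = 0 ->
    forall i, x i = 0
}.

Lemma gauge_le (R : realType) (I : finType) (Phi : (I -> R) -> R)
    (x z : I -> R) :
  gauge Phi -> (forall i, 0 <= z i <= x i) -> Phi z <= Phi x.
Proof.
move=> gPhi zx; have x0 i : 0 <= x i by have /andP[/le_trans] := zx i; apply.
have := @gauge_sublinear _ _ _ gPhi x x z 1 0 ler01 (lexx _) x0 x0.
by rewrite mul1r mul0r addr0; apply=> i; rewrite mul1r mul0r addr0.
Qed.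

(** The absolute value makes the functional nonnegative on all functions. *)
Lemma sum_gauge (R : realType) (I : finType) :
  gauge (fun x : I -> R => `|\sum_i x i|).
Proof.
split=> [x|x y z a b a0 b0 x0 y0 zxy|x x0 /eqP].
- exact: normr_ge0.
- rewrite !ger0_norm ?sumr_ge0 // => [|i _]; last by case/andP: (zxy i).
  rewrite !mulr_sumr -big_split ler_sum // => i _.
  by case/andP: (zxy i).
- rewrite normr_eq0 psumr_eq0 // => /allP s0 i.
  by apply/eqP/s0; rewrite mem_index_enum.
Qed.

(** Young's inequality for the conjugate exponents 1/t and 1/(1-t); the end
    points, where one exponent is infinite, are trivial. *)
Lemma weighted_AM_GM (R : realType) (t a b : R) : 0 <= t <= 1 ->
  0 <= a -> 0 <= b -> a `^ t * b `^ (1 - t) <= t * a + (1 - t) * b.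
Proof.
move=> /andP[t0 t1] a0 b0.
have [->|tN0] := eqVneq t 0.
  by rewrite subr0 powRr0 powRr1 // mul0r add0r !mul1r.
have [->|tN1] := eqVneq t 1.
  by rewrite subrr powRr0 powRr1 // mul0r addr0 mulr1 mul1r.
have s0 : 0 < t by rewrite lt_neqAle eq_sym tN0.
have s1 : 0 < 1 - t by rewrite subr_gt0 lt_neqAle tN1.
have := @conjugate_powR R (a `^ t) (b `^ (1 - t)) t^-1 (1 - t)^-1
  (powR_ge0 _ _) (powR_ge0 _ _).
rewrite !invr_gt0 s0 s1 !invrK subrKC => /(_ isT isT erefl).
rewrite -!powRrM !divff ?gt_eqF // !powRr1 //.
by rewrite ![_ * t]mulrC ![_ * (1 - t)]mulrC.
Qed.

(** When both gauges are nonzero, the weighted AM-GM inequality applies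
    entrywise to x / Phi x and y / Phi y, and sublinearity concludes.
    Definiteness takes care of a vanishing gauge, where normalizing is
    impossible. *)
Lemma gauge_hoelder (R : realType) (I : finType) (Phi : (I -> R) -> R)
    (x y : I -> R) (t : R) :
  gauge Phi -> 0 <= t <= 1 -> (forall i, 0 <= x i) -> (forall i, 0 <= y i) ->
  Phi (fun i => x i `^ t * y i `^ (1 - t)) <= Phi x `^ t * Phi y `^ (1 - t).
Proof.
move=> gPhi t01 x0 y0; case/andP: (t01) => t0 t1.
have z0 i : 0 <= x i `^ t * y i `^ (1 - t) by rewrite mulr_ge0 ?powR_ge0.
have [tE|tN0] := eqVneq t 0.
  rewrite tE subr0 powRr0 mul1r powRr1 ?(gauge_ge0 gPhi) //.
  by apply: gauge_le => [//|i]; rewrite powRr0 powRr1 // mul1r y0 lexx.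
have [tE|tN1] := eqVneq t 1.
  rewrite tE subrr powRr0 mulr1 powRr1 ?(gauge_ge0 gPhi) //.
  by apply: gauge_le => [//|i]; rewrite powRr0 powRr1 // mulr1 x0 lexx.
have sN0 : 1 - t != 0 by rewrite subr_eq0 eq_sym.
have vanish w : Phi w = 0 -> (forall i, 0 <= w i) ->
    (forall i, w i = 0 -> x i `^ t * y i `^ (1 - t) = 0) ->
    Phi (fun i => x i `^ t * y i `^ (1 - t)) <= 0.
  move=> w0 wp wz; rewrite -w0; apply: gauge_le => // i.
  by have E := gauge_eq0 gPhi wp w0 i; rewrite z0 (wz _ E) E lexx.
have [Px|PxN] := eqVneq (Phi x) 0.
  rewrite Px powR0 // mul0r; apply: (vanish x) => // i ->.
  by rewrite powR0 // mul0r.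
have [Py|PyN] := eqVneq (Phi y) 0.
  rewrite Py (powR0 sN0) mulr0; apply: (vanish y) => // i ->.
  by rewrite (powR0 sN0) mulr0.
have Px0 : 0 < Phi x by rewrite lt_neqAle eq_sym PxN (gauge_ge0 gPhi).
have Py0 : 0 < Phi y by rewrite lt_neqAle eq_sym PyN (gauge_ge0 gPhi).
set c := Phi x `^ t * Phi y `^ (1 - t).
have c0 : 0 <= c by rewrite mulr_ge0 ?powR_ge0.
have -> : c = c * t / Phi x * Phi x + c * (1 - t) / Phi y * Phi y.
  by rewrite !divfK // -mulrDr subrKC mulr1.
apply: gauge_sublinear => // [| |i].
- by apply: divr_ge0; [exact: mulr_ge0|exact: ltW].
- by apply: divr_ge0; [apply: mulr_ge0 => //; rewrite subr_ge0|exact: ltW].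
rewrite z0 /=.
have -> : x i `^ t * y i `^ (1 - t) =
    c * ((x i / Phi x) `^ t * (y i / Phi y) `^ (1 - t)).
  rewrite mulrACA -!powRM ?divr_ge0 ?(ltW Px0) ?(ltW Py0) //.
  by rewrite ![Phi _ * _]mulrC !divfK.
have -> : c * t / Phi x * x i + c * (1 - t) / Phi y * y i =
    c * (t * (x i / Phi x) + (1 - t) * (y i / Phi y)) by field; rewrite PxN PyN.
by rewrite ler_wpM2l // weighted_AM_GM // divr_ge0 // ltW.
Qed.

Definition topprod (R : realType) (n : nat) (d : 'I_n -> R) (k : nat) : R :=
  \prod_(i < n | (i < k)%N) d i.

(** The multiplicative form of a transfer from the rich entry j to the poor
    entry k: the product of the two entries is kept, and one of them reaches
    its target.  The new values are xj and yj * yk / xj if the latter does not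
    exceed xk, and otherwise yj * yk / xk and xk. *)
Lemma product_transfer (R : realType) (xj xk yj yk : R) :
  0 < yk -> yk < xk -> xk <= xj -> xj < yj ->
  exists u w, [/\ u * w = yj * yk, xj <= u < yj, yk < w <= xk &
    (u == xj) || (w == xk)].
Proof.
move=> yk0 ykxk xkxj xjyj.
have xk0 : 0 < xk by exact: lt_trans ykxk.
have xj0 : 0 < xj by exact: lt_le_trans xkxj.
have [le|/ltW ge] := leP (yj * yk) (xj * xk).
  exists xj, (yj * yk / xj); split; rewrite ?eqxx ?lexx //.
    by rewrite mulrC divfK ?gt_eqF.
  rewrite ltr_pdivlMr // ler_pdivrMr // [xk * _]mulrC le andbT.
  by rewrite mulrC ltr_pM2r.
exists (yj * yk / xk), xk; split; rewrite ?eqxx ?lexx ?orbT ?ykxk //.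
  by rewrite divfK ?gt_eqF.
rewrite ler_pdivlMr // ge ltr_pdivrMr // ltr_pM2l //.
by apply: lt_trans xjyj.
Qed.

(** By induction on the number of indices where x and y differ.  If x is not
    below y, let k be the first index with y k < x k; since the first k+1
    entries of x have product at most that of y, some j < k has x j < y j.  A
    transfer between j and k fixes one of these entries and keeps the
    hypotheses.  It does not increase the gauge, because a product-preserving
    transfer has a smaller sum and so lies below a convex combination of y and
    y with j and k exchanged. *)
Lemma log_dominance (R : realType) (n : nat) (Phi : ('I_n -> R) -> R)
    (x y : 'I_n -> R) :
  gauge Phi ->
  (forall (z : 'I_n -> R) (s : {perm 'I_n}), Phi (fun i => z (s i)) = Phi z) ->
  (forall i, 0 <= x i) -> (forall i, 0 <= y i) ->
  (forall i j : 'I_n, (i <= j)%N -> x j <= x i) ->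
  (forall k, topprod x k <= topprod y k) ->
  Phi x <= Phi y.
Proof.
move=> gPhi symPhi x0 y0 xsort.
have [m] := ubnP #|[set i | x i != y i]|.
elim: m y y0 => // m IHm y y0 ltm dom.
have [/forallP xy|] := boolP [forall i, x i <= y i].
  by apply: gauge_le => // i; rewrite x0 xy.
rewrite negb_forall => /existsP[k0 Pk0].
case: (@arg_minnP _ k0 (fun i => ~~ (x i <= y i)) (fun i => i : nat) Pk0).
move=> k; rewrite -ltNge => ykxk kmin.
have below (i : 'I_n) : (i < k)%N -> x i <= y i.
  by move=> ik; apply: contraLR ik => /kmin; rewrite -leqNgt.
have xk0 : 0 < x k by apply: le_lt_trans ykxk.
have prodS (z : 'I_n -> R) : topprod z k.+1 = z k * topprod z k.
  rewrite /topprod (bigD1 k) //=; congr (_ * _); apply: eq_bigl => i.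
  by rewrite ltnS ltn_neqAle andbC.
have prodx0 : 0 < topprod x k.+1.
  by apply: prodr_gt0 => i ik; apply: lt_le_trans (xsort i k _).
have yk0 : 0 < y k.
  rewrite lt_neqAle y0 andbT eq_sym; apply: contraTneq (dom k.+1) => yk.
  by rewrite prodS [X in _ <= X]prodS yk mul0r -ltNge -prodS.
have [j /andP[jk xjyj]] : exists j : 'I_n, (j < k)%N && (x j < y j).
  apply/existsP; apply: contraTT (dom k.+1); rewrite negb_exists => /forallP h.
  have exy : topprod y k = topprod x k.
    apply: eq_bigr => i ik; apply/le_anti; rewrite below // andbT leNgt.
    by have := h i; rewrite ik.
  rewrite -ltNge !prodS exy ltr_pM2r //.
  by move: prodx0; rewrite prodS pmulr_rgt0.
have [u [w [uw /andP[xju uyj] /andP[ykw wxk] fixed]]] :=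
  product_transfer yk0 ykxk (xsort _ _ (ltnW jk)) xjyj.
have neq_kj : k != j by apply: contraTneq jk => ->; rewrite ltnn.
pose y' (i : 'I_n) := if i == j then u else if i == k then w else y i.
have y'j : y' j = u by rewrite /y' eqxx.
have y'k : y' k = w by rewrite /y' (negPf neq_kj) eqxx.
have y'E (i : 'I_n) : i != j -> i != k -> y' i = y i.
  by rewrite /y' => /negPf-> /negPf->.
have xj0 : 0 < x j by apply: lt_le_trans (xsort _ _ (ltnW jk)).
have u0 : 0 < u by apply: lt_le_trans xju.
have w0 : 0 < w by apply: lt_trans ykw.
have y'0 i : 0 <= y' i.
  by rewrite /y'; case: ifP => _; [exact: ltW|case: ifP => _ //; exact: ltW].
apply: (@le_trans _ _ (Phi y')).
  apply: IHm => // [|l].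
    rewrite -ltnS; apply: leq_trans ltm; rewrite ltnS; apply: proper_card.
    apply/properP; split.
      apply/subsetP => i; rewrite !inE /y'.
      have [->|_] := eqVneq i j; first by rewrite (lt_eqF xjyj).
      by have [->|_ //] := eqVneq i k; rewrite (gt_eqF ykxk).
    case/orP: fixed => /eqP E.
      by exists j; rewrite !inE; [rewrite (lt_eqF xjyj)|rewrite y'j E eqxx].
    by exists k; rewrite !inE; [rewrite (gt_eqF ykxk)|rewrite y'k E eqxx].
  (* Before k the comparison is termwise; from k on both entries are present,
     and the product is that of y. *)
  have [lk|kl] := leqP l k.
    apply: ler_prod => i il; rewrite x0 /= /y'.
    case: eqP => [->//|_]; case: eqP => [ik|_].
      by move: il; rewrite ik ltnNge lk.
    by rewrite below // (leq_trans il).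
  apply: (le_trans (dom l)); rewrite le_eqVlt; apply/orP; left; apply/eqP.
  have split2 (z : 'I_n -> R) : topprod z l = z j * z k *
      \prod_(i < n | [&& (i < l)%N, i != j & i != k]) z i.
    rewrite /topprod (bigD1 j) ?(ltn_trans jk) //= (bigD1 k) ?kl ?neq_kj //=.
    rewrite mulrA; congr (_ * _); apply: eq_bigl => i.
    by rewrite andbA.
  rewrite !split2 y'j y'k uw; congr (_ * _); apply: eq_bigr => i.
  by case/and3P=> _ ij ik; rewrite y'E.
(* The weight making the convex combination exact at j. *)
pose a := (u - y k) / (y j - y k).
have ujk : y k < u.
  by apply: lt_le_trans xju; apply: lt_le_trans (xsort _ _ (ltnW jk)).
have d0 : 0 < y j - y k by rewrite subr_gt0; apply: lt_trans uyj.
have a0 : 0 <= a by rewrite divr_ge0 ?subr_ge0 // ltW // -subr_gt0.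
have a1 : 0 <= 1 - a by rewrite subr_ge0 ler_pdivrMr // mul1r lerD2r ltW.
have aE : a * (y j - y k) = u - y k by rewrite divfK ?gt_eqF.
have Ey : Phi y = a * Phi y + (1 - a) * Phi (fun i => y (tperm j k i)).
  by rewrite symPhi -mulrDl subrKC mul1r.
rewrite Ey; apply: gauge_sublinear => // i; rewrite y'0 /=.
have [->|ij] := eqVneq i j.
  by rewrite y'j tpermL; lra.
have [->|ik] := eqVneq i k; last first.
  rewrite y'E // tpermD; [|by rewrite eq_sym..].
  by rewrite -mulrDl subrKC mul1r.
rewrite y'k tpermR.
have : 0 <= (y j - u) * (u - y k).
  by rewrite mulr_ge0 // subr_ge0 ltW.
have -> : (y j - u) * (u - y k) = u * (y j + y k - u - w).
  by rewrite !mulrDr !mulrN uw; ring.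
by rewrite pmulr_rge0 //; lra.
Qed.

(** * Gram determinants and minors *)

(** Expansion of the determinant along each row of A *m B, a combination of the
    rows of B. *)
Lemma det_mulmx_rect (K : comPzRingType) (k n : nat) (A : 'M[K]_(k, n))
    (B : 'M[K]_(n, k)) :
  \det (A *m B) = \sum_(f : {ffun 'I_k -> 'I_n})
    (\prod_i A i (f i)) * \det (rowsub f B).
Proof.
transitivity (\sum_(f : {ffun 'I_k -> 'I_n}) \sum_(s : 'S_k)
    (-1) ^+ s * \prod_i (A i (f i) * B (f i) (s i))).
  rewrite exchange_big; apply: eq_bigr => /= s _; rewrite -big_distrr /=.
  congr (_ * _); rewrite -(bigA_distr_bigA (fun i j => A i j * B j (s i))) /=.
  by apply: eq_bigr => x _; rewrite mxE.
apply: eq_bigr => f _; rewrite big_distrr /=; apply: eq_bigr => s _.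
rewrite mulrCA big_split; congr (_ * (_ * _)).
by apply: eq_bigr => i _; rewrite mxE.
Qed.

(** Summing over all maps f instead of over k-subsets spares the choice of
    increasing enumerations: injective maps with the same image contribute
    equally, which accounts for the factor k`!, and the others contribute 0.
    The proof averages the row expansion over all reorderings of the rows. *)
Lemma Cauchy_Binet (K : comPzRingType) (k n : nat) (A : 'M[K]_(k, n))
    (B : 'M[K]_(n, k)) :
  \det (A *m B) *+ k`! = \sum_(f : {ffun 'I_k -> 'I_n})
    \det (colsub f A) * \det (rowsub f B).
Proof.
have perm_f (s : 'S_k) : \det (A *m B) = \sum_(f : {ffun 'I_k -> 'I_n})
    (-1) ^+ s * (\prod_i A (s i) (f i)) * \det (rowsub f B).
  pose act (u : 'S_k) (f : {ffun 'I_k -> 'I_n}) := [ffun i => f (u i)].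
  have actK u : cancel (act u) (act u^-1%g).
    by move=> f; apply/ffunP => i; rewrite !ffunE permKV.
  rewrite det_mulmx_rect (reindex_inj (can_inj (actK s^-1%g))) /=.
  apply: eq_bigr => f _; rewrite mulrAC [in RHS]mulrC; congr (_ * _).
    rewrite (reindex_perm s); apply: eq_bigr => i _.
    by rewrite ffunE permK.
  have -> : rowsub (act s^-1%g f) B = perm_mx s^-1%g *m rowsub f B.
    by rewrite -row_permE; apply/matrixP => i j; rewrite !mxE ffunE.
  by rewrite det_mulmx det_perm odd_permV.
rewrite -card_Sn -sumr_const (eq_bigr _ (fun s _ => perm_f s)) exchange_big /=.
apply: eq_bigr => f _; rewrite -[\det (colsub f A)]det_tr big_distrl /=.
apply: eq_big => // s _; congr (_ * _ * _).
by apply: eq_bigr => i _; rewrite !mxE.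
Qed.

Definition rdiag_mx (R : realType) (n : nat) (d : 'I_n -> R) : 'M[R[i]]_n :=
  diag_mx (\row_i (d i)%:C).

Definition minor2 (R : realType) (n k : nat) (W : 'M[R[i]]_(n, k))
  (f : {ffun 'I_k -> 'I_n}) : R := normc (\det (rowsub f W)) ^+ 2.

(** This is det (W^* W), by gramE; the sum of squared minors makes it visibly
    real and nonnegative. *)
Definition gram (R : realType) (n k : nat) (W : 'M[R[i]]_(n, k)) : R :=
  (\sum_f minor2 W f) / k`!%:R.

Lemma norm_normc (R : realType) (z : R[i]) : `|z| = (normc z)%:C.
Proof. by []. Qed.

Lemma normc_ge0 (R : realType) (z : R[i]) : 0 <= normc z.
Proof. by rewrite -ler0c -norm_normc. Qed.

Lemma normc_real (R : realType) (a : R) : normc a%:C = `|a|.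
Proof. by rewrite /= expr0n /= addr0 sqrtr_sqr. Qed.

Lemma minor2_ge0 (R : realType) (n k : nat) (W : 'M[R[i]]_(n, k)) f :
  0 <= minor2 W f.
Proof. exact: sqr_ge0. Qed.

Lemma gram_ge0 (R : realType) (n k : nat) (W : 'M[R[i]]_(n, k)) :
  0 <= gram W.
Proof. by rewrite divr_ge0 ?ler0n // sumr_ge0 // => f _; exact: minor2_ge0. Qed.

Lemma fact_neq0 (F : numDomainType) k : k`!%:R != 0 :> F.
Proof. by rewrite pnatr_eq0 -lt0n fact_gt0. Qed.

Lemma det_adj_colsub (R : realType) (n k : nat) (W : 'M[R[i]]_(n, k))
    (f : 'I_k -> 'I_n) :
  \det (colsub f (W^t*)) = Num.conj (\det (rowsub f W)).
Proof.
rewrite -det_map_mx -det_tr; congr (\det _).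
by apply/matrixP => i j; rewrite !mxE.
Qed.

Lemma gramE (R : realType) (n k : nat) (W : 'M[R[i]]_(n, k)) :
  \det (W^t* *m W) = (gram W)%:C.
Proof.
apply: (mulIf (fact_neq0 R[i] k)); rewrite mulr_natr Cauchy_Binet.
rewrite -(rmorph_nat (real_complex R)) -rmorphM divfK ?fact_neq0 //.
rewrite rmorph_sum; apply: eq_bigr => f _ /=.
by rewrite det_adj_colsub mulrC -normCK norm_normc -rmorphXn.
Qed.

Lemma gram_eq (R : realType) (n m k : nat) (W : 'M[R[i]]_(n, k))
    (V : 'M[R[i]]_(m, k)) :
  W^t* *m W = V^t* *m V -> gram W = gram V.
Proof. by move=> E; apply: complexI; rewrite -!gramE E. Qed.

(** Cauchy-Schwarz on the exterior power: by Cauchy-Binet the determinant is the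
    inner product of the vectors of minors. *)
Lemma gram_Schwarz (R : realType) (n k : nat) (U V : 'M[R[i]]_(n, k)) :
  normc (\det (U^t* *m V)) ^+ 2 <= gram U * gram V.
Proof.
have fact0 : 0 < k`!%:R :> R by rewrite ltr0n fact_gt0.
set u := minor2 U; set v := minor2 V.
have u0 f : 0 <= u f by exact: minor2_ge0.
have v0 f : 0 <= v f by exact: minor2_ge0.
rewrite /gram mulrACA -invfM ler_pdivlMr ?mulr_gt0 // -!expr2 -exprMn.
have half01 : 0 <= (2^-1 : R) <= 1 by lra.
have := gauge_hoelder (sum_gauge R {ffun 'I_k -> 'I_n}) half01 u0 v0.
have -> : 1 - 2^-1 = 2^-1 :> R by field.
rewrite !powR12_sqrt // !ger0_norm ?sumr_ge0 //; last first.
  by move=> f _; rewrite mulr_ge0 ?powR_ge0.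
have su : 0 <= \sum_f u f by exact: sumr_ge0.
have sv : 0 <= \sum_f v f by exact: sumr_ge0.
rewrite -sqrtrM // => h; rewrite -[X in _ <= X]sqr_sqrtr ?mulr_ge0 //.
rewrite lerXn2r ?nnegrE ?mulr_ge0 ?normc_ge0 ?sqrtr_ge0 ?ler0n //.
apply: le_trans h; rewrite -lecR rmorphM rmorph_nat mulr_natr.
rewrite /= -norm_normc -normrMn Cauchy_Binet rmorph_sum.
apply: (le_trans (ler_norm_sum _ _ _)).
rewrite ler_sum // => f _; rewrite det_adj_colsub normrM norm_conjC !norm_normc.
rewrite -rmorphM lecR /u /v /minor2 !powR12_sqrt ?sqr_ge0 // !sqrtr_sqr.
by rewrite !ger0_norm ?normc_ge0.
Qed.

Lemma minor2_rdiag (R : realType) (n k : nat) (d : 'I_n -> R)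
    (W : 'M[R[i]]_(n, k)) f :
  minor2 (rdiag_mx d *m W) f = (\prod_i d (f i)) ^+ 2 * minor2 W f.
Proof.
rewrite /minor2.
have -> : rowsub f (rdiag_mx d *m W) =
    rdiag_mx (fun i => d (f i)) *m rowsub f W.
  by rewrite /rdiag_mx !mul_diag_mx; apply/matrixP => i j; rewrite !mxE.
rewrite det_mulmx normcM exprMn; congr (_ * _).
rewrite det_diag (eq_bigr (fun i => (d (f i))%:C)) => [|i _].
  by rewrite -rmorph_prod normc_real real_normK ?num_real.
by rewrite mxE.
Qed.

(** By induction on the size of S, removing its largest element m: a set of
    size k+1 has an element of index at least k. *)
Lemma prod_set_le_topprod (R : realType) (n : nat) (d : 'I_n -> R) :
  (forall i, 0 <= d i) -> (forall i j : 'I_n, (i <= j)%N -> d j <= d i) ->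
  forall S : {set 'I_n}, \prod_(i in S) d i <= topprod d #|S|.
Proof.
move=> d0 dsort S; move E : #|S| => k.
elim: k S E => [|k IHk] S cS.
  by rewrite (cards0_eq cS) big_set0 /topprod big_pred0.
have [i0 i0S] : exists i, i \in S by apply/set0Pn; rewrite -card_gt0 cS.
case: (@arg_maxnP _ i0 (mem S) (fun i : 'I_n => i : nat) i0S) => m mS mmax.
have km : (k <= m)%N.
  rewrite -ltnS -cS cardE -(size_map val) -(size_iota 0 m.+1).
  apply: uniq_leq_size => [|_ /mapP[i iS ->]].
    by rewrite map_inj_uniq ?enum_uniq //; exact: val_inj.
  by rewrite mem_enum in iS; rewrite mem_iota /= ltnS; exact: mmax iS.
have kn : (k < n)%N by apply: leq_ltn_trans km _.
rewrite (big_setD1 m) //= /topprod [X in _ <= X](bigD1 (Ordinal kn)) //=.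
have -> : \prod_(i < n | (i < k.+1)%N && (i != Ordinal kn)) d i = topprod d k.
  by apply: eq_bigl => i; rewrite -val_eqE /= ltnS [RHS]ltn_neqAle andbC.
rewrite ler_pM // ?prodr_ge0 //; first exact: dsort.
by apply: IHk; have := cardsD1 m S; rewrite cS (mS : m \in S) => -[].
Qed.

(** Each minor is scaled by a product of k entries of d at distinct positions;
    minors with a repeated row vanish. *)
Lemma gram_rdiag_le (R : realType) (n k : nat) (d : 'I_n -> R)
    (W : 'M[R[i]]_(n, k)) :
  (forall i, 0 <= d i) -> (forall i j : 'I_n, (i <= j)%N -> d j <= d i) ->
  gram (rdiag_mx d *m W) <= topprod d k ^+ 2 * gram W.
Proof.
move=> d0 dsort; rewrite /gram mulrA ler_pM2r ?invr_gt0 ?ltr0n ?fact_gt0 //.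
rewrite mulr_sumr ler_sum // => f _; rewrite minor2_rdiag.
have [/injectiveP injf|/injectivePn[i [j ij fij]]] := boolP (injectiveb f).
  rewrite ler_wpM2r ?minor2_ge0 // lerXn2r ?nnegrE ?prodr_ge0 //.
  have := prod_set_le_topprod d0 dsort (f @: setT).
  rewrite card_imset // cardsT card_ord big_imset /=; last first.
    by move=> ? ? _ _ /injf.
  by under eq_bigl do rewrite inE.
rewrite /minor2 (determinant_alternate ij) => [|l]; last by rewrite !mxE fij.
by rewrite normc0 expr0n /= !mulr0.
Qed.

Lemma prod_powR (R : realType) (I : Type) (r : seq I) (P : pred I) (d : I -> R)
    (t : R) : (forall i, 0 <= d i) ->
  \prod_(i <- r | P i) d i `^ t = (\prod_(i <- r | P i) d i) `^ t.
Proof.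
move=> d0; elim: r => [|i r IHr]; first by rewrite !big_nil powR1.
by rewrite !big_cons; case: ifP => // _; rewrite powRM ?prodr_ge0 // IHr.
Qed.

(** Hoelder's inequality over the minors: each squared minor of W is scaled by
    the square of a product of entries of d, raised to the power t. *)
Lemma gram_rdiag_powR (R : realType) (n k : nat) (d : 'I_n -> R) (t : R)
    (W : 'M[R[i]]_(n, k)) :
  (forall i, 0 <= d i) -> 0 <= t <= 1 ->
  gram (rdiag_mx (fun i => d i `^ t) *m W)
    <= gram (rdiag_mx d *m W) `^ t * gram W `^ (1 - t).
Proof.
move=> d0 t01.
have dm0 f : 0 <= minor2 (rdiag_mx d *m W) f by exact: minor2_ge0.
have := gauge_hoelder (sum_gauge R _) t01 dm0 (@minor2_ge0 _ _ _ W).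
have fact0 : 0 <= k`!%:R^-1 :> R by rewrite invr_ge0 ler0n.
rewrite !ger0_norm ?sumr_ge0 // => [h||f _]; first last.
- by rewrite mulr_ge0 ?powR_ge0.
- by move=> f _; exact: minor2_ge0.
rewrite /gram !powRM ?sumr_ge0 // => [|f _]; last exact: minor2_ge0.
rewrite mulrACA -powRD; last by rewrite subrKC oner_eq0.
rewrite subrKC powRr1 // ler_wpM2r //.
apply: le_trans h; rewrite le_eqVlt; apply/orP; left; apply/eqP.
apply: eq_bigr => f _; rewrite !minor2_rdiag.
rewrite powRM ?sqr_ge0 ?minor2_ge0 // -mulrA.
rewrite -powRD; last by rewrite subrKC oner_eq0.
rewrite subrKC powRr1 ?minor2_ge0 //; congr (_ * _).
by rewrite prod_powR // !expr2 powRM ?prodr_ge0.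
Qed.

(** * Functional calculus and singular values *)

Lemma adjmxM (R : realType) (m n p : nat) (A : 'M[R[i]]_(m, n))
    (B : 'M[R[i]]_(n, p)) : (A *m B)^t* = B^t* *m A^t*.
Proof. by rewrite trmx_mul map_mxM. Qed.

Lemma unitarymx_adj (R : realType) (n : nat) (U : 'M[R[i]]_n) :
  U \is unitarymx -> U *m U^t* = 1%:M /\ U^t* *m U = 1%:M.
Proof. by move=> hU; have UU := unitarymxP hU; split=> //; exact: mulmx1C. Qed.

Lemma rdiag_mxM (R : realType) (n : nat) (d e : 'I_n -> R) :
  rdiag_mx d *m rdiag_mx e = rdiag_mx (fun i => d i * e i).
Proof.
rewrite /rdiag_mx mulmx_diag; congr diag_mx.
by apply/rowP => i; rewrite !mxE rmorphM.
Qed.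

Lemma rdiag_mx_eq (R : realType) (n : nat) (d e : 'I_n -> R) :
  d =1 e -> rdiag_mx d = rdiag_mx e.
Proof. by move=> de; congr diag_mx; apply/rowP => i; rewrite !mxE de. Qed.

Lemma rdiag_mx1 (R : realType) (n : nat) :
  rdiag_mx (fun=> 1) = 1%:M :> 'M[R[i]]_n.
Proof.
by rewrite -diag_const_mx; congr diag_mx; apply/rowP => i; rewrite !mxE.
Qed.

Lemma rdiag_mx_adj (R : realType) (n : nat) (d : 'I_n -> R) :
  (rdiag_mx d)^t* = rdiag_mx d.
Proof.
rewrite /rdiag_mx tr_diag_mx map_diag_mx; congr diag_mx.
by apply/rowP => i; rewrite !mxE; exact: conjc_real.
Qed.

Lemma perm_mx_unitary (R : realType) (n : nat) (s : 'S_n) :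
  (perm_mx s : 'M[R[i]]_n) \is unitarymx.
Proof.
apply/unitarymxP.
by rewrite tr_perm_mx map_perm_mx -perm_mxM mulgV perm_mx1.
Qed.

Lemma rdiag_mx_perm (R : realType) (n : nat) (d : 'I_n -> R) (s : 'S_n) :
  rdiag_mx (fun i => d (s i)) = perm_mx s *m rdiag_mx d *m (perm_mx s)^t*.
Proof.
rewrite tr_perm_mx map_perm_mx -row_permE -col_permE.
by apply/matrixP => i j; rewrite !mxE (inj_eq perm_inj).
Qed.

(** The functional calculus does not depend on the diagonalization: the matrix
    carrying V to the spectral basis intertwines the two diagonals, so its
    nonzero entries link equal eigenvalues, and it intertwines their powers. *)
Lemma mxpowR_diag (R : realType) (n : nat) (V : 'M[R[i]]_n) (d : 'I_n -> R)
    (p : R) :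
  V \is unitarymx ->
  mxpowR (V^t* *m rdiag_mx d *m V) p
    = V^t* *m rdiag_mx (fun i => d i `^ p) *m V.
Proof.
move=> hV; have [VV VV'] := unitarymx_adj hV.
set M := V^t* *m _ *m V.
have hM : M \is normalmx.
  have MM : M^t* = M by rewrite !adjmxM trmxCK rdiag_mx_adj mulmxA.
  by apply/normalmxP; rewrite MM.
have hS := spectral_unitarymx M; have [SS SS'] := unitarymx_adj hS.
have /orthomx_spectralP ME := hM; rewrite invmx_unitary // in ME.
rewrite /mxpowR; set S := spectralmx M in hS SS SS' ME *.
set sp := spectral_diag M in ME *.
have Q : S *m V^t* *m rdiag_mx d = diag_mx sp *m (S *m V^t*).
  have /(congr1 (fun Z => S *m Z *m V^t*)) : M = M by [].
  rewrite {1}/M {1}ME !mulmxA SS mul1mx => <-.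
  by rewrite -!mulmxA VV mulmx1.
rewrite -[RHS]mul1mx -SS' -!mulmxA; congr (_ *m _).
rewrite -[S in LHS]mulmx1 -VV' !mulmxA; congr (_ *m _).
rewrite -mulmxA; move: (S *m V^t*) Q => W Q.
apply/matrixP => i j; move/matrixP/(_ i j): Q.
rewrite !mul_diag_mx !mul_mx_diag !mxE.
have [->|W0 E] := eqVneq (W i j) 0; first by rewrite !mul0r !mulr0.
by rewrite mulrC; congr (_ * _); move: E; rewrite mulrC => /(mulIf W0) <-.
Qed.

Lemma sort_perm (R : realType) (n : nat) (d : 'I_n -> R) :
  exists s : 'S_n, forall i j : 'I_n, (i <= j)%N -> d (s j) <= d (s i).
Proof.
pose t := [tuple d i | i < n].
have /tuple_permP[s E] : perm_eq (sort (fun x y => y <= x) t) t.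
  by rewrite perm_sort.
have srt : sorted (fun x y : R => y <= x) (sort (fun x y => y <= x) t).
  by apply: sort_sorted => x y; exact: le_total.
exists s => i j ij; rewrite E in srt.
have := @sorted_leq_nth _ (fun x y : R => y <= x) _ _ 0 _ srt i j.
rewrite !inE !size_tuple !ltn_ord => H.
have := H (rev_trans (@le_trans _ _)) (@lexx _ _) isT isT ij.
by rewrite -!tnth_nth !tnth_mktuple.
Qed.

Lemma psd_diag (R : realType) (n : nat) (A : 'M[R[i]]_n) : psdmx A ->
  exists V d, [/\ V \is unitarymx, forall i, 0 <= d i,
    forall i j : 'I_n, (i <= j)%N -> d j <= d i &
    A = V^t* *m rdiag_mx d *m V].
Proof.
move=> [hA posA]; have hS := spectral_unitarymx A.
have [SS SS'] := unitarymx_adj hS.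
have /orthomx_spectralP AE := hermitian_normalmx hA.
rewrite invmx_unitary // in AE; have real_sp := hermitian_spectral_diag_real hA.
set S := spectralmx A in hS SS SS' AE; set sp := spectral_diag A in AE real_sp.
have sp0 i : 0 <= sp 0 i.
  have := posA (S^t* *m delta_mx i 0).
  rewrite AE adjmxM trmxCK !mulmxA -[_ *m S *m S^t*]mulmxA SS mulmx1.
  rewrite -[_ *m S *m S^t*]mulmxA SS mulmx1 trmx_delta map_delta_mx.
  by rewrite -rowE -colE !mxE eqxx.
pose d i := complex.Re (sp 0 i).
have spE : diag_mx sp = rdiag_mx d.
  by congr diag_mx; apply/rowP => i; rewrite mxE RRe_real ?(mxOverP real_sp).
have d0 i : 0 <= d i by rewrite -ler0c RRe_real ?(mxOverP real_sp).
have [s hs] := sort_perm d.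
have hP := perm_mx_unitary R s; have [_ PP] := unitarymx_adj hP.
exists (perm_mx s *m S), (fun i => d (s i)).
split; [exact: mul_unitarymx|by move=> i; exact: d0|exact: hs|].
rewrite (rdiag_mx_perm d) adjmxM {1}AE spE !mulmxA.
by rewrite -!(mulmxA _ ((perm_mx s)^t*) (perm_mx s)) PP !mulmx1.
Qed.

Lemma psd_gram (R : realType) (n : nat) (T : 'M[R[i]]_n) : psdmx (T^t* *m T).
Proof.
split; first by apply/is_hermitianmxP; rewrite expr0 scale1r adjmxM trmxCK.
move=> x; rewrite !mulmxA -adjmxM -mulmxA mxE sumr_ge0 // => i _.
by rewrite !mxE mulrC -normCK exprn_ge0.
Qed.

(** The singular values s come with the right singular vectors V only: powers
    of |T| involve T through T^* T alone. *)
Definition singular_decomp (R : realType) (n : nat) (T V : 'M[R[i]]_n)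
    (s : 'I_n -> R) : Prop :=
  [/\ V \is unitarymx, forall i, 0 <= s i,
    forall i j : 'I_n, (i <= j)%N -> s j <= s i &
    T^t* *m T = V^t* *m rdiag_mx (fun i => s i ^+ 2) *m V].

Lemma singular_decomp_exists (R : realType) (n : nat) (T : 'M[R[i]]_n) :
  exists V s, singular_decomp T V s.
Proof.
have [V [d [hV d0 dsort E]]] := psd_diag (psd_gram T).
exists V, (fun i => Num.sqrt (d i)); split; first exact: hV.
- by move=> i; exact: sqrtr_ge0.
- by move=> i j ij; rewrite ler_wsqrtr // dsort.
rewrite E (@rdiag_mx_eq _ _ (fun i => Num.sqrt (d i) ^+ 2) d) // => i.
by rewrite sqr_sqrtr.
Qed.

Lemma mxpowR_mxabs (R : realType) (n : nat) (T V : 'M[R[i]]_n) s r :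
  singular_decomp T V s ->
  mxpowR (mxabs T) r = V^t* *m rdiag_mx (fun i => s i `^ r) *m V.
Proof.
move=> [hV s0 _ E]; rewrite /mxabs E (mxpowR_diag _ _ hV).
rewrite (@rdiag_mx_eq _ _ _ s) ?(mxpowR_diag _ _ hV) // => i.
by rewrite powR12_sqrt ?sqr_ge0 // sqrtr_sqr ger0_norm.
Qed.

Lemma gram_unitary (R : realType) (n k : nat) (V : 'M[R[i]]_n)
    (W : 'M[R[i]]_(n, k)) :
  V \is unitarymx -> gram (V *m W) = gram W.
Proof.
move=> /unitarymx_adj[_ VV]; apply: gram_eq.
by rewrite adjmxM mulmxA -[_ *m V^t* *m V]mulmxA VV mulmx1.
Qed.

(** P_k(T) bounds the norm of T on decomposable k-vectors. *)
Lemma gram_mul_le (R : realType) (n k : nat) (T V : 'M[R[i]]_n) s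
    (W : 'M[R[i]]_(n, k)) :
  singular_decomp T V s -> gram (T *m W) <= topprod s k ^+ 2 * gram W.
Proof.
move=> [hV s0 ssort E].
have -> : gram (T *m W) = gram (rdiag_mx s *m (V *m W)).
  apply: gram_eq; rewrite !adjmxM rdiag_mx_adj !mulmxA.
  rewrite -[_ *m T^t* *m T]mulmxA E -[_ *m rdiag_mx s *m rdiag_mx s]mulmxA.
  by rewrite rdiag_mxM !mulmxA (rdiag_mx_eq (fun i => expr2 (s i))).
by rewrite -(gram_unitary W hV); exact: gram_rdiag_le.
Qed.

(** W consists of the k leading right singular vectors, on which the bound of
    gram_mul_le is attained. *)
Lemma top_frame (R : realType) (n k : nat) (T V : 'M[R[i]]_n) s :
  (k <= n)%N -> singular_decomp T V s ->
  exists (W : 'M[R[i]]_(n, k)) (L : 'M[R[i]]_k),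
    [/\ W^t* *m W = 1%:M, T^t* *m T *m W = W *m L &
        \det L = (topprod s k ^+ 2)%:C].
Proof.
move=> kn [hV s0 ssort E]; have [VV VV'] := unitarymx_adj hV.
pose e : 'M[R[i]]_(n, k) := pid_mx k.
exists (V^t* *m e), (rdiag_mx (fun j => s (widen_ord kn j) ^+ 2)).
split.
- rewrite adjmxM trmxCK mulmxA -[_ *m V *m V^t*]mulmxA VV mulmx1.
  by rewrite tr_pid_mx map_pid_mx mul_pid_mx minnn (minn_idPr kn) pid_mx_1.
- rewrite E !mulmxA -[_ *m V *m V^t*]mulmxA VV mulmx1 -!mulmxA; congr (_ *m _).
  rewrite /rdiag_mx mul_diag_mx mul_mx_diag; apply/matrixP => i j; rewrite !mxE.
  have [ij|] := eqVneq (i : nat) j; last by rewrite mulr0 mul0r.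
  by rewrite mulrC; congr (_ * (s _ ^+ 2)%:C); apply: val_inj.
rewrite det_diag /topprod (big_ord_narrow kn) -prodrXl rmorph_prod.
by apply: eq_bigr => i _; rewrite mxE.
Qed.

Lemma gram1 (R : realType) (n k : nat) (W : 'M[R[i]]_(n, k)) :
  W^t* *m W = 1%:M -> gram W = 1.
Proof. by move=> E; apply: complexI; rewrite -gramE E det1. Qed.

Lemma top_frame_gram (R : realType) (n k : nat) (T : 'M[R[i]]_n)
    (W : 'M[R[i]]_(n, k)) (L : 'M[R[i]]_k) (c : R) :
  W^t* *m W = 1%:M -> T^t* *m T *m W = W *m L -> \det L = c%:C ->
  gram (T *m W) = c.
Proof.
move=> W1 TW Lc; apply: complexI; rewrite -gramE -Lc adjmxM.
by rewrite -(mulmxA (W^t*)) (mulmxA (T^t*)) TW mulmxA W1 mul1mx.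
Qed.

Lemma gram_mulr (R : realType) (n k : nat) (W : 'M[R[i]]_(n, k))
    (M : 'M[R[i]]_k) :
  gram (W *m M) = gram W * normc (\det M) ^+ 2.
Proof.
apply: complexI.
have -> : (gram W * normc (\det M) ^+ 2)%:C = (gram W)%:C * `|\det M| ^+ 2.
  by rewrite norm_normc -rmorphXn -rmorphM.
rewrite -!gramE adjmxM.
rewrite -mulmxA (mulmxA (W^t*)) !det_mulmx det_map_mx det_tr normCK.
by rewrite mulrCA [Num.conj _ * _]mulrC.
Qed.

Lemma topprod_ge0 (R : realType) (n : nat) (d : 'I_n -> R) k :
  (forall i, 0 <= d i) -> 0 <= topprod d k.
Proof. by move=> d0; exact: prodr_ge0. Qed.

(** If W is a top frame of T^* with eigenvalue matrix L, then T^* W has Gram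
    determinant det L, while T maps it to W L, of Gram determinant (det L)^2. *)
Lemma topprod_adj_le (R : realType) (n k : nat) (T V V' : 'M[R[i]]_n) s s' :
  (k <= n)%N -> singular_decomp T V s -> singular_decomp (T^t*) V' s' ->
  topprod s' k <= topprod s k.
Proof.
move=> kn hT hT'; have [W [L [W1 TW detL]]] := top_frame kn hT'.
have [_ s0 _ _] := hT; have [_ s'0 _ _] := hT'.
have [->|pN] := eqVneq (topprod s' k) 0; first exact: topprod_ge0.
have p0 : 0 < topprod s' k by rewrite lt_neqAle eq_sym pN topprod_ge0.
have gZ := top_frame_gram W1 TW detL.
have gTZ : gram (T *m (T^t* *m W)) = topprod s' k ^+ 4.
  rewrite trmxCK -mulmxA in TW.
  rewrite TW gram_mulr (gram1 W1) detL normc_real mul1r.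
  by rewrite ger0_norm ?sqr_ge0 -?exprM.
have := gram_mul_le (T^t* *m W) hT.
rewrite gTZ gZ (exprD _ 2 2) ler_pM2r ?exprn_gt0 // => h.
by rewrite -(@ler_pXn2r _ 2) ?nnegrE ?topprod_ge0.
Qed.

(** * Log-convexity of products of leading singular values *)

Lemma powR_sqr (R : realType) (a t : R) :
  0 <= a -> (a ^+ 2) `^ t = (a `^ t) ^+ 2.
Proof. by move=> a0; rewrite !expr2 powRM. Qed.

Lemma mulmx_sandwich (K : pzSemiRingType) (m n p q r : nat) (P : 'M[K]_(m, n))
    (Q : 'M[K]_(p, r)) (V : 'M[K]_(n, q)) (U : 'M[K]_(q, n)) (M : 'M[K]_(n, n))
    (N : 'M[K]_(n, p)) :
  V *m U = 1%:M -> P *m M *m V *m (U *m N *m Q) = P *m (M *m N) *m Q.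
Proof. by move=> VU; rewrite !mulmxA -(mulmxA _ V) VU mulmx1. Qed.

Lemma mulmxA_rev (K : pzSemiRingType) (m n p q r t : nat) (A : 'M[K]_(m, n))
    (B : 'M[K]_(n, p)) (C : 'M[K]_(p, q)) (D : 'M[K]_(q, r))
    (E : 'M[K]_(r, t)) :
  A *m B *m C *m D *m E = A *m (B *m (C *m (D *m E))).
Proof. by rewrite !mulmxA. Qed.

Lemma psd_mxpowR (R : realType) (n : nat) (A : 'M[R[i]]_n) : psdmx A ->
  exists (V : 'M[R[i]]_n) (d : 'I_n -> R),
    [/\ V \is unitarymx, forall i, 0 <= d i,
    A = V^t* *m rdiag_mx d *m V &
    forall p, mxpowR A p = V^t* *m rdiag_mx (fun i => d i `^ p) *m V].
Proof.
move=> /psd_diag[V [d [hV d0 _ ->]]]; exists V, d; split=> // p.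
exact: mxpowR_diag.
Qed.

Lemma mxpowR_adj (R : realType) (n : nat) (A : 'M[R[i]]_n) p : psdmx A ->
  (mxpowR A p)^t* = mxpowR A p.
Proof.
move=> /psd_mxpowR[V [d [_ _ _ /(_ p)->]]].
by rewrite !adjmxM trmxCK rdiag_mx_adj mulmxA.
Qed.

Lemma mxpowR_split (R : realType) (n : nat) (A : 'M[R[i]]_n) p q : psdmx A ->
  p + q = 1 -> mxpowR A p *m mxpowR A q = A.
Proof.
move=> /psd_mxpowR[V [d [/unitarymx_adj[VV _] d0 AE pow]]] pq; rewrite !pow AE.
rewrite (mulmx_sandwich _ _ _ _ VV) rdiag_mxM.
rewrite (rdiag_mx_eq (_ : _ =1 d)) // => i.
by rewrite -powRD pq ?oner_eq0 // powRr1.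
Qed.

Lemma adj_bimul (R : realType) (n : nat) (A B X : 'M[R[i]]_n) (p p' q q' : R) :
  psdmx A -> psdmx B -> p + p' = 1 ->
  (mxpowR A p *m X *m mxpowR B q)^t* *m (mxpowR A p' *m X *m mxpowR B q')
    = mxpowR B q *m (X^t* *m A *m X) *m mxpowR B q'.
Proof.
move=> hA hB pp; rewrite -[in RHS](mxpowR_split hA pp).
move: (mxpowR_adj p hA) (mxpowR_adj q hB) (mxpowR A p') (mxpowR B q').
move: (mxpowR A p) (mxpowR B q) => a b aa bb a' b'.
by rewrite !adjmxM aa bb !mulmxA.
Qed.

(** On the top frame W of A^t Y, Hoelder's inequality over the minors of V Y W,
    with V diagonalizing A, bounds the Gram determinant of A^t Y W by those of
    A Y W and Y W. *)
Lemma topprod_mxpowRl (R : realType) (n k : nat) (A Y : 'M[R[i]]_n) (t : R)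
    (Vt V1 V0 : 'M[R[i]]_n) (st s1 s0 : 'I_n -> R) :
  (k <= n)%N -> psdmx A -> 0 <= t <= 1 ->
  singular_decomp (mxpowR A t *m Y) Vt st ->
  singular_decomp (A *m Y) V1 s1 -> singular_decomp Y V0 s0 ->
  topprod st k <= topprod s1 k `^ t * topprod s0 k `^ (1 - t).
Proof.
move=> kn hA t01 ht h1 h0; have [W [L [W1 TW detL]]] := top_frame kn ht.
have gt := top_frame_gram W1 TW detL.
have [V [d [hV d0 AE pow]]] := psd_mxpowR hA.
have [_ st0 _ _] := ht; have [_ s10 _ _] := h1; have [_ s00 _ _] := h0.
have g1 := gram_mul_le W h1; have g0 := gram_mul_le W h0.
rewrite (gram1 W1) mulr1 in g1; rewrite (gram1 W1) mulr1 in g0.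
have hVt : V^t* \is unitarymx by rewrite trmxC_unitary.
have rot e : gram (V^t* *m rdiag_mx e *m V *m Y *m W) =
    gram (rdiag_mx e *m (V *m (Y *m W))).
  by rewrite mulmxA_rev; exact: gram_unitary.
have := gram_rdiag_powR (V *m (Y *m W)) d0 t01.
rewrite -!rot -pow -AE gt gram_unitary // => h.
rewrite -(@ler_pXn2r _ 2) ?nnegrE ?mulr_ge0 ?powR_ge0 ?topprod_ge0 //.
apply: (le_trans h); rewrite exprMn -!powR_sqr ?topprod_ge0 //.
case/andP: t01 => t0 t1.
apply: ler_pM; [exact: powR_ge0|exact: powR_ge0|apply: ge0_ler_powR|
  apply: ge0_ler_powR]; rewrite ?subr_ge0 ?nnegrE ?gram_ge0 ?sqr_ge0 //.
Qed.

(** Cyclic permutation of factors for eigenvectors: an invariant frame W of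
    b H b yields the invariant frame Z of b1 H b2 with the same action L.  The
    second identity maps Z back to W L^2, so that Z does not degenerate when L
    is invertible, even if b, b1 and b2 are singular. *)
Lemma eigen_chain (K : pzSemiRingType) (n k : nat) (b b1 b2 H : 'M[K]_n)
    (W : 'M[K]_(n, k)) (L : 'M[K]_k) (Z := b1 *m H *m b *m W) :
  b2 *m b1 = b *m b -> b *m H *m b *m W = W *m L ->
  b1 *m H *m b2 *m Z = Z *m L /\ b *m H *m b2 *m Z = W *m (L *m L).
Proof.
move=> bb HW.
have bZ : b2 *m Z = b *m W *m L by rewrite -(mulmxA b) -HW /Z !mulmxA bb.
split; first by rewrite -(mulmxA _ b2) bZ !mulmxA.
by rewrite -(mulmxA _ b2) bZ !mulmxA HW.
Qed.

(** With Z as in eigen_chain, det L = P_k(C)^2 is the ratio between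
    det ((T2 Z)^* (T1 Z)) and det (Z^* Z), and Cauchy-Schwarz bounds the former
    by the norms of T1 and T2. *)
Lemma topprod_similar (R : realType) (n k : nat)
    (b b1 b2 H C T1 T2 : 'M[R[i]]_n)
    (V V1 V2 : 'M[R[i]]_n) (c p1 p2 : 'I_n -> R) :
  (k <= n)%N -> singular_decomp C V c ->
  singular_decomp T1 V1 p1 -> singular_decomp T2 V2 p2 ->
  C^t* *m C = b *m H *m b -> T2^t* *m T1 = b1 *m H *m b2 ->
  b2 *m b1 = b *m b ->
  topprod c k ^+ 2 <= topprod p1 k * topprod p2 k.
Proof.
move=> kn hC h1 h2 CC TT bb.
have [W [L [W1 TW detL]]] := top_frame kn hC.
have [_ c0 _ _] := hC; have [_ p10 _ _] := h1; have [_ p20 _ _] := h2.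
have [->|cN] := eqVneq (topprod c k) 0.
  by rewrite expr0n /= mulr_ge0 ?topprod_ge0.
have cp : 0 < topprod c k by rewrite lt_neqAle eq_sym cN topprod_ge0.
rewrite CC in TW; have [] := eigen_chain bb TW; rewrite -{}TT.
move: (b1 *m H *m b *m W) => Z eigZ KZ.
have normL : normc (\det L) = topprod c k ^+ 2.
  by rewrite detL normc_real ger0_norm ?sqr_ge0.
(* The frame Z is nondegenerate because a matrix maps it to W L^2. *)
have gZ : 0 < gram Z.
  rewrite lt_neqAle gram_ge0 andbT; apply/eqP => Z0.
  have [VK [sK hK]] := singular_decomp_exists (b *m H *m b2).
  have := gram_mul_le Z hK.
  rewrite KZ gram_mulr (gram1 W1) -Z0 mulr0 mul1r det_mulmx normcM normL.
  by rewrite leNgt !(exprn_gt0, mulr_gt0).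
have := gram_Schwarz (T2 *m Z) (T1 *m Z).
rewrite adjmxM -mulmxA (mulmxA (T2^t*)) eigZ mulmxA.
rewrite det_mulmx gramE normcM normL.
rewrite normc_real ger0_norm ?gram_ge0 // => h.
have {h} := le_trans h (ler_pM (gram_ge0 _) (gram_ge0 _)
  (gram_mul_le Z h2) (gram_mul_le Z h1)).
have -> : topprod p2 k ^+ 2 * gram Z * (topprod p1 k ^+ 2 * gram Z)
    = (topprod p1 k * topprod p2 k) ^+ 2 * gram Z ^+ 2 by ring.
have -> : (gram Z * topprod c k ^+ 2) ^+ 2
    = (topprod c k ^+ 2) ^+ 2 * gram Z ^+ 2.
  by ring.
rewrite ler_pM2r ?exprn_gt0 //.
by rewrite ler_pXn2r ?nnegrE ?sqr_ge0 ?mulr_ge0 ?topprod_ge0.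
Qed.

Lemma topprod_midpoint (R : realType) (n k : nat) (A B X : 'M[R[i]]_n) (s t : R)
    (V V1 V2 : 'M[R[i]]_n) (c p1 p2 : 'I_n -> R) :
  (k <= n)%N -> psdmx A -> psdmx B ->
  singular_decomp (mxpowR A 2^-1 *m X *m mxpowR B 2^-1) V c ->
  singular_decomp (mxpowR A t *m X *m mxpowR B (1 - s)) V1 p1 ->
  singular_decomp (mxpowR A (1 - t) *m X *m mxpowR B s) V2 p2 ->
  topprod c k ^+ 2 <= topprod p1 k * topprod p2 k.
Proof.
move=> kn hA hB hC h1 h2.
have half2 : 2^-1 + 2^-1 = 1 :> R by field.
apply: (topprod_similar kn hC h1 h2 (adj_bimul X _ _ hA hB half2)
  (adj_bimul X _ _ hA hB (subrK t 1))).
exact: etrans (mxpowR_split hB (subrK s 1)) (esym (mxpowR_split hB half2)).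
Qed.

(** * Unitarily invariant norms *)

Lemma topprod_powR_mean (R : realType) (n : nat) (a b : 'I_n -> R) (r t : R)
    (k : nat) : (forall i, 0 <= a i) -> (forall i, 0 <= b i) ->
  topprod (fun i => (a i `^ r) `^ t * (b i `^ r) `^ (1 - t)) k
    = (topprod a k `^ t * topprod b k `^ (1 - t)) `^ r.
Proof.
move=> a0 b0; rewrite /topprod powRM ?powR_ge0 //.
rewrite (powRAC _ t) (powRAC _ (1 - t)).
by rewrite -!prod_powR // => [|i|i]; [rewrite big_split|exact: powR_ge0..].
Qed.

Lemma le_geometric_mean (R : realType) (x a b : R) :
  0 <= x -> 0 <= a -> 0 <= b ->
  (x <= a `^ 2^-1 * b `^ (1 - 2^-1)) = (x ^+ 2 <= a * b).
Proof.
move=> x0 a0 b0; have -> : 1 - 2^-1 = 2^-1 :> R by field.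
rewrite -powRM // powR12_sqrt ?mulr_ge0 //.
by rewrite -[RHS](@ler_sqrt _ (x ^+ 2)) ?mulr_ge0 // sqrtr_sqr ger0_norm.
Qed.

Section UnitarilyInvariantNorm.
Variables (R : realType) (n : nat) (N : 'M[R[i]]_n -> R).
Hypotheses (hN : mxnorm N) (hNU : unitarily_invariant N).

Let nd (d : 'I_n -> R) := N (rdiag_mx d).

Lemma unitarymx1 : (1%:M : 'M[R[i]]_n) \is unitarymx.
Proof. by apply/unitarymxP; rewrite trmx1 map_mx1 mulmx1. Qed.

Lemma norm_rdiag_comb (x y : 'I_n -> R) (a b : R) : 0 <= a -> 0 <= b ->
  nd (fun i => a * x i + b * y i) <= a * nd x + b * nd y.
Proof.
move=> a0 b0.
have -> : nd (fun i => a * x i + b * y i)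
    = N (a%:C *: rdiag_mx x + b%:C *: rdiag_mx y).
  congr N; apply/matrixP => i j; rewrite !mxE.
  by case: eqP => _; rewrite ?mulr1n ?mulr0n ?mulr0 ?addr0 // rmorphD !rmorphM.
apply: (le_trans (mxnormD hN _ _)).
by rewrite !(mxnormZ hN) !normc_real !ger0_norm.
Qed.

Lemma norm_rdiag_flip (y : 'I_n -> R) (i : 'I_n) :
  nd (fun j => if j == i then - y j else y j) = nd y.
Proof.
pose e (j : 'I_n) : R := if j == i then -1 else 1.
have ue : rdiag_mx e \is unitarymx.
  apply/unitarymxP; rewrite rdiag_mx_adj rdiag_mxM -rdiag_mx1.
  by apply: rdiag_mx_eq => j; rewrite /e; case: eqP => _; rewrite ?mulrNN mulr1.
rewrite /nd -[RHS](hNU _ ue unitarymx1) mulmx1 rdiag_mxM; congr N.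
by apply: rdiag_mx_eq => j; rewrite /e; case: eqP => _; rewrite ?mulN1r ?mul1r.
Qed.

(** Lowering a single entry from y i to x i is a convex combination of y and
    of y with the sign of that entry reversed, and both have the same norm. *)
Lemma norm_rdiag_le (x y : 'I_n -> R) :
  (forall i, 0 <= x i <= y i) -> nd x <= nd y.
Proof.
have [m] := ubnP #|[set i | x i != y i]|.
elim: m y => // m IHm y ltm xy.
have x0 i : 0 <= x i by case/andP: (xy i).
have xley i : x i <= y i by case/andP: (xy i).
have [/forallP e|] := boolP [forall i, x i == y i].
  by rewrite /nd (rdiag_mx_eq (fun i => eqP (e i))).
rewrite negb_forall => /existsP[i xyi].
have yi0 : 0 < y i.
  by apply: le_lt_trans (x0 i) _; rewrite lt_neqAle xyi xley.
pose y' j := if j == i then x i else y j.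
apply: (@le_trans _ _ (nd y')).
  apply: IHm => [|j]; last first.
    by rewrite /y'; case: eqP => [->|_]; rewrite x0 ?lexx ?xley.
  rewrite -ltnS; apply: leq_trans ltm; rewrite ltnS; apply: proper_card.
  apply/properP; split; last by exists i; rewrite !inE ?xyi // /y' eqxx eqxx.
  apply/subsetP => j; rewrite !inE /y'.
  by have [->|//] := eqVneq j i.
pose c := (1 + x i / y i) / 2.
have xy01 : 0 <= x i / y i <= 1.
  by rewrite divr_ge0 ?(ltW yi0) // ler_pdivrMr // mul1r xley.
have [c0 c1] : 0 <= c /\ 0 <= 1 - c.
  by rewrite /c; move: (x i / y i) xy01 => z /andP[]; split; lra.
have -> : nd y
    = c * nd y + (1 - c) * nd (fun j => if j == i then - y j else y j).
  by rewrite norm_rdiag_flip -mulrDl subrKC mul1r.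
apply: le_trans (norm_rdiag_comb _ _ c0 c1).
have y'E : y' =1 fun j => c * y j + (1 - c) * (if j == i then - y j else y j).
  move=> j; rewrite /y' /c; case: eqP => [->|_]; last first.
    by rewrite -mulrDl subrKC mul1r.
  by field; rewrite gt_eqF.
by rewrite /nd (rdiag_mx_eq y'E).
Qed.

Lemma norm_rdiag_gauge : gauge nd.
Proof.
split=> [x|x y z a b a0 b0 x0 y0 zxy|x x0 Nx i].
- exact: mxnorm_ge0 hN _.
- exact: le_trans (norm_rdiag_le zxy) (norm_rdiag_comb _ _ a0 b0).
have /matrixP/(_ i i) := mxnorm_eq0 hN Nx.
by rewrite !mxE eqxx mulr1n => -[].
Qed.

Lemma norm_rdiag_perm (z : 'I_n -> R) (s : {perm 'I_n}) :
  nd (fun i => z (s i)) = nd z.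
Proof.
rewrite /nd rdiag_mx_perm hNU //; first exact: perm_mx_unitary.
by rewrite trmxC_unitary perm_mx_unitary.
Qed.

Variable r : R.
Hypothesis r0 : 0 <= r.

Let nu T := N (mxpowR (mxabs T) r).

Lemma nu_sv (T V : 'M[R[i]]_n) s : singular_decomp T V s ->
  nu T = nd (fun i => s i `^ r).
Proof.
move=> hT; have [hV _ _ _] := hT.
by rewrite /nu (mxpowR_mxabs _ hT); apply: hNU; rewrite ?trmxC_unitary.
Qed.

Lemma topprod_minn (d : 'I_n -> R) k : topprod d k = topprod d (minn k n).
Proof. by apply: eq_bigl => i; rewrite leq_min ltn_ord andbT. Qed.

(** Log-majorization compares T with the diagonal of weighted geometric means
    of the singular values of T1 and T0, and Hoelder's inequality for the
    gauge bounds the norm of that diagonal. *)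
Lemma nu_hoelder (T T1 T0 V V1 V0 : 'M[R[i]]_n) (s s1 s0 : 'I_n -> R) (t : R) :
  0 <= t <= 1 -> singular_decomp T V s -> singular_decomp T1 V1 s1 ->
  singular_decomp T0 V0 s0 ->
  (forall k, (k <= n)%N ->
     topprod s k <= topprod s1 k `^ t * topprod s0 k `^ (1 - t)) ->
  nu T <= nu T1 `^ t * nu T0 `^ (1 - t).
Proof.
move=> t01 h h1 h0 dom; rewrite (nu_sv h) (nu_sv h1) (nu_sv h0).
have [_ p pd _] := h; have [_ p1 _ _] := h1; have [_ p0 _ _] := h0.
apply: le_trans (gauge_hoelder norm_rdiag_gauge t01 _ _);
  try by move=> i; exact: powR_ge0.
apply: (log_dominance norm_rdiag_gauge norm_rdiag_perm) => [i|i|i j ij|k].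
- exact: powR_ge0.
- by rewrite mulr_ge0 ?powR_ge0.
- by rewrite ge0_ler_powR ?nnegrE // pd.
rewrite topprod_minn [X in _ <= X]topprod_minn.
have := dom _ (geq_minr k n); move: (minn k n) => {}k le_k.
rewrite (topprod_powR_mean r t k p1 p0) /topprod prod_powR //.
by rewrite ge0_ler_powR ?nnegrE ?mulr_ge0 ?powR_ge0 ?topprod_ge0.
Qed.

Lemma nu_adj_le (T : 'M[R[i]]_n) : nu (T^t*) <= nu T.
Proof.
have [V [s h]] := singular_decomp_exists T.
have [V' [s' h']] := singular_decomp_exists (T^t*).
have [_ s0 _ _] := h.
have dom k : (k <= n)%N ->
    topprod s' k <= topprod s k `^ 1 * topprod s k `^ (1 - 1).
  move=> kn; rewrite subrr powRr0 mulr1 (powRr1 (topprod_ge0 k s0)).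
  exact: topprod_adj_le kn h h'.
have t01 : 0 <= (1 : R) <= 1 by rewrite ler01 lexx.
have := nu_hoelder t01 h' h h dom.
by rewrite subrr powRr0 mulr1 (powRr1 (mxnorm_ge0 hN _)).
Qed.

Lemma nu_adj (T : 'M[R[i]]_n) : nu (T^t*) = nu T.
Proof.
apply/le_anti/andP; split; first exact: nu_adj_le.
by have := nu_adj_le (T^t*); rewrite trmxCK.
Qed.

Lemma nu_mxpowRl (A Y : 'M[R[i]]_n) (t : R) : psdmx A -> 0 <= t <= 1 ->
  nu (mxpowR A t *m Y) <= nu (A *m Y) `^ t * nu Y `^ (1 - t).
Proof.
move=> hA t01.
have [V [s h]] := singular_decomp_exists (mxpowR A t *m Y).
have [V1 [s1 h1]] := singular_decomp_exists (A *m Y).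
have [V0 [s0 h0]] := singular_decomp_exists Y.
apply: (nu_hoelder t01 h h1 h0) => k kn.
exact: topprod_mxpowRl kn hA t01 h h1 h0.
Qed.

Lemma nu_mxpowRr (B Y : 'M[R[i]]_n) (t : R) : psdmx B -> 0 <= t <= 1 ->
  nu (Y *m mxpowR B t) <= nu (Y *m B) `^ t * nu Y `^ (1 - t).
Proof.
move=> hB t01; have := nu_mxpowRl (Y^t*) hB t01.
have BB : B^t* = B.
  by have [/is_hermitianmxP] := hB; rewrite expr0 scale1r => <-.
by rewrite -{1}(mxpowR_adj t hB) -{2}BB -!adjmxM !nu_adj.
Qed.

Lemma nu_midpoint (A B X : 'M[R[i]]_n) (s t : R) : psdmx A -> psdmx B ->
  nu (mxpowR A 2^-1 *m X *m mxpowR B 2^-1) ^+ 2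
    <= nu (mxpowR A t *m X *m mxpowR B (1 - s))
       * nu (mxpowR A (1 - t) *m X *m mxpowR B s).
Proof.
move=> hA hB.
have [V [c h]] := singular_decomp_exists (mxpowR A 2^-1 *m X *m mxpowR B 2^-1).
have [V1 [p1 h1]] :=
  singular_decomp_exists (mxpowR A t *m X *m mxpowR B (1 - s)).
have [V2 [p2 h2]] :=
  singular_decomp_exists (mxpowR A (1 - t) *m X *m mxpowR B s).
have half01 : 0 <= (2^-1 : R) <= 1 by lra.
have [_ c0 _ _] := h; have [_ p10 _ _] := h1; have [_ p20 _ _] := h2.
rewrite -(le_geometric_mean (mxnorm_ge0 hN _) (mxnorm_ge0 hN _)
  (mxnorm_ge0 hN _)).
apply: (nu_hoelder half01 h h1 h2) => k kn.
rewrite (le_geometric_mean (topprod_ge0 k c0) (topprod_ge0 k p10)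
  (topprod_ge0 k p20)).
exact: topprod_midpoint kn hA hB h h1 h2.
Qed.

(** Convexity in each exponent, first in that of A, then in that of B on the
    two sides A^1 and A^0 of the square. *)
Lemma nu_corners (A B X : 'M[R[i]]_n) (u t : R) : psdmx A -> psdmx B ->
  0 <= u <= 1 -> 0 <= t <= 1 ->
  nu (mxpowR A t *m X *m mxpowR B u)
    <= (nu (A *m X *m B) `^ u * nu (A *m X) `^ (1 - u)) `^ t
       * (nu (X *m B) `^ u * nu X `^ (1 - u)) `^ (1 - t).
Proof.
move=> hA hB u01 t01; rewrite -mulmxA.
have := nu_mxpowRl (X *m mxpowR B u) hA t01.
move=> /le_trans; apply; rewrite mulmxA; case/andP: t01 => t0 t1.
have nu0 T : 0 <= nu T by exact: mxnorm_ge0 hN _.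
apply: ler_pM; [exact: powR_ge0|exact: powR_ge0|apply: ge0_ler_powR|
  apply: ge0_ler_powR]; rewrite ?subr_ge0 ?nnegrE ?mulr_ge0 ?powR_ge0 ?nu0 //;
  exact: nu_mxpowRr.
Qed.

End UnitarilyInvariantNorm.

Lemma powR_mean_le (R : realType) (x y m t : R) : 0 <= t <= 1 ->
  0 <= x <= m -> 0 <= y <= m -> x `^ t * y `^ (1 - t) <= m.
Proof.
move=> t01 /andP[x0 xm] /andP[y0 ym].
apply: (le_trans (weighted_AM_GM t01 x0 y0)).
case/andP: t01 => t0 t1; have -> : m = t * m + (1 - t) * m by ring.
by rewrite lerD // ler_wpM2l // subr_ge0.
Qed.

(** The factors regroup into weighted geometric means of the products b c and
    a d of opposite corners: p collects those with exponent t, and q those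
    with exponent 1 - t. *)
Lemma corner_bound (R : realType) (a b c d s t : R) :
  0 <= a -> 0 <= b -> 0 <= c -> 0 <= d -> 0 <= s <= 1 -> 0 <= t <= 1 ->
  (a `^ (1 - s) * b `^ s) `^ t * (c `^ (1 - s) * d `^ s) `^ (1 - t)
  * ((a `^ s * b `^ (1 - s)) `^ (1 - t) * (c `^ s * d `^ (1 - s)) `^ t)
  <= Num.max (b * c) (a * d).
Proof.
move=> a0 b0 c0 d0 s01 t01; set m := Num.max _ _.
have bcm : 0 <= b * c <= m by rewrite mulr_ge0 // le_max lexx.
have adm : 0 <= a * d <= m by rewrite mulr_ge0 // le_max lexx orbT.
set p := (b * c) `^ s * (a * d) `^ (1 - s).
set q := (a * d) `^ s * (b * c) `^ (1 - s).
have pm : 0 <= p <= m by rewrite mulr_ge0 ?powR_ge0 // powR_mean_le.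
have qm : 0 <= q <= m by rewrite mulr_ge0 ?powR_ge0 // powR_mean_le.
have pE : p = (a `^ (1 - s) * b `^ s) * (c `^ s * d `^ (1 - s)).
  rewrite /p !powRM //.
  by move: (a `^ _) (b `^ _) (c `^ _) (d `^ _) => *; ring.
have qE : q = (c `^ (1 - s) * d `^ s) * (a `^ s * b `^ (1 - s)).
  rewrite /q !powRM //.
  by move: (a `^ _) (b `^ _) (c `^ _) (d `^ _) => *; ring.
apply: le_trans (powR_mean_le t01 pm qm).
rewrite pE qE !(powRM _ (mulr_ge0 (powR_ge0 _ _) (powR_ge0 _ _))
  (mulr_ge0 (powR_ge0 _ _) (powR_ge0 _ _))).
by rewrite [X in _ * X <= _]mulrC [X in X <= _]mulrACA.
Qed.

Theorem corollary2p4 (R : realType) (n : nat) (A B X : 'M[R[i]]_n) (r : R)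
    (N : 'M[R[i]]_n -> R)
    (hA : psdmx A) (hB : psdmx B) (hr : 0 <= r)
    (hN : mxnorm N) (hNU : unitarily_invariant N) :
  forall s t : R, 0 <= s <= 1 -> 0 <= t <= 1 ->
    N (mxpowR (mxabs (mxpowR A 2^-1 *m X *m mxpowR B 2^-1)) r) ^+ 2
      <= N (mxpowR (mxabs (mxpowR A t *m X *m mxpowR B (1 - s))) r)
         * N (mxpowR (mxabs (mxpowR A (1 - t) *m X *m mxpowR B s)) r)
    /\
    N (mxpowR (mxabs (mxpowR A t *m X *m mxpowR B (1 - s))) r)
      * N (mxpowR (mxabs (mxpowR A (1 - t) *m X *m mxpowR B s)) r)
      <= Num.max
           (N (mxpowR (mxabs (A *m X)) r) * N (mxpowR (mxabs (X *m B)) r))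
           (N (mxpowR (mxabs (A *m X *m B)) r) * N (mxpowR (mxabs X) r)).
Proof.
move=> s t s01 t01; split; first exact: nu_midpoint.
have u01 : 0 <= 1 - s <= 1 by lra.
have v01 : 0 <= 1 - t <= 1 by lra.
have N0 T : 0 <= N T by exact: mxnorm_ge0 hN _.
apply: (le_trans (ler_pM (N0 _) (N0 _)
  (nu_corners hN hNU hr X hA hB u01 t01)
  (nu_corners hN hNU hr X hA hB s01 v01))).
rewrite !subKr.
exact: corner_bound.
Qed.
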